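(* (i) The $\mathcal{F}$-theory of the natural numbers, i.e. the set of sentences of $\mathcal{F}$ that are true in $(\mathbb{N},+,\cdot,<,0,1)$, is decidable. (ii) Every $\mathcal{F}$-formula is equivalent in $\mathbb{N}$ to a quantifier-free formula; that is, for every $\phi(x_1,\dots,x_m)$ in $\mathcal{F}$ there is a quantifier-free $\mathcal{L}$-formula $\psi(x_1,\dots,x_m)$ such that for all $n_1,\dots,n_m\in\mathbb{N}$, $(\mathbb{N},+,\cdot,<,0,1)\models\phi(n_1,\dots,n_m)$ if and only if $(\mathbb{N},+,\cdot,<,0,1)\models\psi(n_1,\dots,n_m)$.
   Context: Let $\mathcal{L}=\{+,\cdot,<,0,1\}$ be the language of ordered rings (first-order logic with equality), and let $\mathbb{N}=\{0,1,2,\dots\}$. Let $Q$ be a new quantifier symbol. If $\mathcal{M}=(M,<,\dots)$ is a linearly ordered $\mathcal{L}$-structure, then $\mathcal{M}\models Qx\,\phi$ is defined to mean $\mathcal{M}\models\exists z\,\forall x>z\ \phi$ (with $z$ a variable not occurring in $\phi$), i.e. ''$\phi$ holds for all sufficiently large $x$''; $\phi$ may have other free variables, interpreted as parameters. $\mathcal{F}$ is the smallest collection of $\mathcal{L}$-formulas containing all quantifier-free formulas and closed under propositional connectives and under the quantifier $Q$ (i.e. if $\phi\in\mathcal{F}$ then $Qx\,\phi\in\mathcal{F}$ for each variable $x$). A sentence is a formula without free variables. *)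

(* Defs.v *)
From mathcomp Require Import all_boot.
Set Implicit Arguments.
Unset Strict Implicit.
Unset Printing Implicit Defensive.

(* Variables are named by natural numbers. *)
Inductive term : Type :=
  | Var of nat
  | Zero
  | One
  | Add of term & term
  | Mul of term & term.

(* First-order formulas over {+, *, <, 0, 1} with the extra quantifier [Q]. *)
Inductive formula : Type :=
  | Eq of term & term
  | Lt of term & term
  | Not of formula
  | And of formula & formula
  | Or of formula & formula
  | Imp of formula & formula
  | Ex of nat & formula
  | All of nat & formula
  | Q of nat & formula.

Fixpoint term_vars (t : term) : seq nat :=
  match t with
  | Var x => [:: x]
  | Zero | One => [::]
  | Add t u | Mul t u => term_vars t ++ term_vars u
  end.

Fixpoint free_vars (p : formula) : seq nat :=
  match p with
  | Eq t u | Lt t u => term_vars t ++ term_vars u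
  | Not p => free_vars p
  | And p q | Or p q | Imp p q => free_vars p ++ free_vars q
  | Ex x p | All x p | Q x p => [seq y <- free_vars p | y != x]
  end.

Definition sentence (p : formula) : Prop := free_vars p = [::].

Fixpoint quantifier_free (p : formula) : bool :=
  match p with
  | Eq _ _ | Lt _ _ => true
  | Not p => quantifier_free p
  | And p q | Or p q | Imp p q => quantifier_free p && quantifier_free q
  | Ex _ _ | All _ _ | Q _ _ => false
  end.

Inductive in_F : formula -> Prop :=
  | F_qf p : quantifier_free p -> in_F p
  | F_not p : in_F p -> in_F (Not p)
  | F_and p q : in_F p -> in_F q -> in_F (And p q)
  | F_or p q : in_F p -> in_F q -> in_F (Or p q)
  | F_imp p q : in_F p -> in_F q -> in_F (Imp p q)
  | F_Q x p : in_F p -> in_F (Q x p).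

Fixpoint eval (s : nat -> nat) (t : term) : nat :=
  match t with
  | Var x => s x
  | Zero => 0
  | One => 1
  | Add t u => eval s t + eval s u
  | Mul t u => eval s t * eval s u
  end.

(* [sat s p]: the structure (nat, +, *, <, 0, 1) satisfies [p] under the
   assignment [s]. *)
Fixpoint sat (s : nat -> nat) (p : formula) : Prop :=
  match p with
  | Eq t u => eval s t = eval s u
  | Lt t u => eval s t < eval s u
  | Not p => ~ sat s p
  | And p q => sat s p /\ sat s q
  | Or p q => sat s p \/ sat s q
  | Imp p q => sat s p -> sat s q
  | Ex x p => exists a, sat [eta s with x |-> a] p
  | All x p => forall a, sat [eta s with x |-> a] p
  | Q x p => exists z, forall a, z < a -> sat [eta s with x |-> a] p
  end.

(* The truth of a sentence does not depend on the assignment. *)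
Definition F_theory (p : formula) : Prop :=
  [/\ in_F p, sentence p & forall s, sat s p].

(* The total recursive functions: the least class of functions on the naturals
   containing zero, successor and projections, and closed under composition,
   primitive recursion (on the first argument) and minimization of regular
   functions. *)
Inductive recursive : forall k, (k.-tuple nat -> nat) -> Prop :=
  | rec_zero : recursive (fun _ : 0.-tuple nat => 0)
  | rec_succ : recursive (fun v : 1.-tuple nat => (thead v).+1)
  | rec_proj k (i : 'I_k) : recursive (fun v : k.-tuple nat => tnth v i)
  | rec_comp k m (g : m.-tuple nat -> nat) (f : 'I_m -> k.-tuple nat -> nat) :
      recursive g -> (forall i, recursive (f i)) ->
      recursive (fun v : k.-tuple nat => g [tuple f i v | i < m])
  | rec_prim k (g : k.-tuple nat -> nat) (h : k.+2.-tuple nat -> nat)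
      (f : k.+1.-tuple nat -> nat) :
      recursive g -> recursive h ->
      (forall v : k.-tuple nat, f [tuple of 0 :: v] = g v) ->
      (forall n (v : k.-tuple nat), f [tuple of n.+1 :: v] =
                   h [tuple of n :: f [tuple of n :: v] :: v]) ->
      recursive f
  | rec_mu k (g : k.+1.-tuple nat -> nat) (f : k.-tuple nat -> nat) :
      recursive g ->
      (forall v : k.-tuple nat, g [tuple of f v :: v] = 0) ->
      (forall (v : k.-tuple nat) n, n < f v -> g [tuple of n :: v] <> 0) ->
      recursive f
  | rec_ext k (f g : k.-tuple nat -> nat) :
      recursive f -> f =1 g -> recursive g.

Definition recursive_set (S : nat -> Prop) : Prop :=
  exists2 f : 1.-tuple nat -> nat, recursive f &
    forall n, (S n -> f [tuple n] = 1) /\ (~ S n -> f [tuple n] = 0).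

(* Cantor's pairing function; 'C(n.+1, 2) is the n-th triangular number. *)
Definition pair_code (a b : nat) : nat := 'C((a + b).+1, 2) + b.

Fixpoint term_code (t : term) : nat :=
  match t with
  | Zero => 0
  | One => 1
  | Var x => 3 * x + 2
  | Add t u => 3 * pair_code (term_code t) (term_code u) + 3
  | Mul t u => 3 * pair_code (term_code t) (term_code u) + 4
  end.

Fixpoint formula_code (p : formula) : nat :=
  match p with
  | Eq t u => 9 * pair_code (term_code t) (term_code u) + 0
  | Lt t u => 9 * pair_code (term_code t) (term_code u) + 1
  | Not p => 9 * formula_code p + 2
  | And p q => 9 * pair_code (formula_code p) (formula_code q) + 3
  | Or p q => 9 * pair_code (formula_code p) (formula_code q) + 4
  | Imp p q => 9 * pair_code (formula_code p) (formula_code q) + 5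
  | Ex x p => 9 * pair_code x (formula_code p) + 6
  | All x p => 9 * pair_code x (formula_code p) + 7
  | Q x p => 9 * pair_code x (formula_code p) + 8
  end.

Lemma pair_code_inj a b c d :
  pair_code a b = pair_code c d -> a = c /\ b = d.
Proof.
have lt_pair x y x' y' : x + y < x' + y' -> pair_code x y < pair_code x' y'.
  move=> lt_xy; rewrite /pair_code.
  apply: (@leq_trans 'C((x' + y').+1, 2)); last exact: leq_addr.
  apply: (@leq_trans 'C((x + y).+2, 2)); last exact: leq_bin2l.
  by rewrite [X in _ < X]binS bin1 ltn_add2l ltnS leq_addl.
case: (ltngtP (a + b) (c + d)) => [/lt_pair | /lt_pair | eq_s].
- by move=> lt e; rewrite e ltnn in lt.
- by move=> lt e; rewrite e ltnn in lt.
rewrite /pair_code eq_s => /addnI eq_bd; split=> //.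
by move: eq_s; rewrite eq_bd => /addIn.
Qed.

Lemma tag_inj k i j a b :
  i < k -> j < k -> k * a + i = k * b + j -> a = b /\ i = j.
Proof.
move=> ik jk e; have k0 : 0 < k by exact: leq_ltn_trans ik.
have := congr1 (divn^~ k) e; have := congr1 (modn^~ k) e.
rewrite !(mulnC k) !modnMDl !divnMDl // !modn_small // !divn_small //.
by rewrite !addn0.
Qed.

Lemma term_code_inj : injective term_code.
Proof.
have tag x y i j : i < 3 -> j < 3 ->
    3 * x + i.+2 = 3 * y + j.+2 -> x = y /\ i = j.
  by move=> i3 j3; rewrite !addnS => -[] /(tag_inj i3 j3).
elim=> [x||| t IHt u IHu | t IHt u IHu] [y||| t' u' | t' u'] //=;
  try by rewrite ?addnS.
all: move/tag => /(_ isT isT) [] //.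
- by move=> ->.
- by case/pair_code_inj => /IHt -> /IHu ->.
- by case/pair_code_inj => /IHt -> /IHu ->.
Qed.

Lemma formula_code_inj : injective formula_code.
Proof.
have tag i j a b : i < 9 -> j < 9 -> 9 * a + i = 9 * b + j -> a = b /\ i = j.
  exact: tag_inj.
elim=> [t u|t u|p IHp|p IHp q IHq|p IHp q IHq|p IHp q IHq
       |x p IHp|x p IHp|x p IHp]
  [t' u'|t' u'|p'|p' q'|p' q'|p' q'|x' p'|x' p'|x' p']
  /tag => /(_ isT isT) [] //.
all: try by case/pair_code_inj => /term_code_inj -> /term_code_inj ->.
all: try by case/pair_code_inj => /IHp -> /IHq ->.
all: try by case/pair_code_inj => -> /IHp ->.
by move/IHp ->.
Qed.

Definition decidable_formulas (A : formula -> Prop) : Prop :=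
  recursive_set (fun n => exists2 p, n = formula_code p & A p).

(* Main.v *)
(* A comparison of two polynomials in x at a value a exceeding all their
   coefficients is a comparison of two numbers written in base a, that is, a
   lexicographic comparison of the coefficients. Hence an atom with free variable
   x is equivalent, for all large x, to a quantifier-free condition on the
   coefficients; this eliminates Q.
   How large x must be is bounded by an elementary function of the formula and of
   the values of the other variables. So the truth of Q x p can be tested at one
   explicit value of x, and the truth of a sentence is computed by a recursion on
   the formula which carries the values chosen so far; a stack machine implements
   it as a recursive function. *)
Require Import Defs.
From mathcomp Require Import all_boot all_algebra.
From Corelib Require Import Setoid.
Set Implicit Arguments.
Unset Strict Implicit.
Unset Printing Implicit Defensive.

(** * Elimination of Q *)

Import GRing.Theory.

(** For decidability the elimination is only a proof tool: the recursive function never builds a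
    quantifier-free formula. The test value of an inner quantifier depends on the outer ones, so the
    argument compares whole environments. Two environments over the same variables, in each of which
    every value dominates the earlier ones, satisfy the same formulas with suitably bounded terms,
    because the most recent variable can be eliminated from both. The obstacle is that elimination
    enlarges terms, so a threshold measured by their size would change at every elimination. The
    bound is therefore semantic: a term is at most [M ^ N] whenever its variables are at most [M]. A
    coefficient is at most the value of its term at [x = 1], so it inherits the exponent [N]. As the
    naturals have no subtraction, an atom remains a comparison of two polynomials and never becomes
    the sign of a difference. *)

Fixpoint coef (x : nat) (t : term) (i : nat) : term :=
  match t with
  | Var y => if y == x then (if i == 1 then One else Zero)
             else (if i == 0 then Var y else Zero)
  | Zero => Zero
  | One => if i == 0 then One else Zero
  | Add t u => Add (coef x t i) (coef x u i)
  | Mul t u => \big[Add/Zero]_(j < i.+1) Mul (coef x t j) (coef x u (i - j))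
  end.

Fixpoint poly_of (s : nat -> nat) (x : nat) (t : term) : {poly nat} :=
  match t with
  | Var y => if y == x then ('X)%R else ((s y)%:P)%R
  | Zero => 0%R
  | One => 1%R
  | Add t u => (poly_of s x t + poly_of s x u)%R
  | Mul t u => (poly_of s x t * poly_of s x u)%R
  end.

Lemma coef_poly_of s x t i : eval s (coef x t i) = ((poly_of s x t)`_i)%R.
Proof.
elim: t i => [y|||t IHt u IHu|t IHt u IHu] i /=.
- case: (y == x); first by rewrite coefX; case: (i == 1).
  by rewrite coefC; case: (i == 0).
- by rewrite coef0.
- by rewrite coef1; case: (i == 0).
- by rewrite coefD -IHt -IHu.
rewrite coefM (big_morph (eval s) (op1 := addn) (id1 := 0)) //.
by apply: eq_bigr => j _; rewrite -IHt -IHu.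
Qed.

Lemma horner_poly_of s x t a :
  ((poly_of s x t).[a])%R = eval [eta s with x |-> a] t.
Proof.
elim: t => [y|||t IHt u IHu|t IHt u IHu] /=.
- by case: (y == x); rewrite ?hornerX ?hornerC.
- by rewrite horner0.
- by rewrite hornerC.
- by rewrite hornerD IHt IHu.
by rewrite hornerM IHt IHu.
Qed.

(** A bound on the size of the polynomial (degree plus one) rather than a degree: 2 is the size of
    ['X], and the sum covers both addition and multiplication. *)
Fixpoint deg (t : term) : nat :=
  match t with
  | Var _ | Zero | One => 2
  | Add t u | Mul t u => deg t + deg u
  end.

Lemma size_poly_of s x t : size (poly_of s x t) <= deg t.
Proof.
elim: t => [y|||t IHt u IHu|t IHt u IHu] /=.
- case: (y == x); first by rewrite size_polyX.
  exact: leq_trans (size_polyC_leq1 _) _.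
- by rewrite size_poly0.
- by rewrite size_poly1.
- apply: leq_trans (size_polyD _ _) _.
  by rewrite geq_max (leq_trans IHt (leq_addr _ _)) (leq_trans IHu (leq_addl _ _)).
apply: leq_trans (size_polyMleq _ _) _.
by apply: leq_trans (leq_pred _) _; apply: leq_add.
Qed.

Lemma eval_coef s x t a n : deg t <= n ->
  eval [eta s with x |-> a] t = \sum_(i < n) eval s (coef x t i) * a ^ i.
Proof.
move=> le_n; rewrite -horner_poly_of.
rewrite (horner_coef_wide _ (leq_trans (size_poly_of s x t) le_n)).
by apply: eq_bigr => i _; rewrite coef_poly_of -natrXE.
Qed.

(** At [x = 1] a polynomial takes the sum of its coefficients as value, and these are natural
    numbers. *)
Lemma eval_coef_le s x t i : eval s (coef x t i) <= eval [eta s with x |-> 1] t.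
Proof.
(* The summation range is lengthened so that it contains [i] even beyond the degree bound. *)
rewrite (@eval_coef _ _ _ _ (deg t + i.+1)) ?leq_addr //.
have lt_i : i < deg t + i.+1 by rewrite addnS ltnS leq_addl.
by rewrite (bigD1 (Ordinal lt_i)) //= exp1n muln1 leq_addr.
Qed.

Lemma term_vars_coef x t i :
  {subset term_vars (coef x t i) <= [seq y <- term_vars t | y != x]}.
Proof.
elim: t i => [y|||t IHt u IHu|t IHt u IHu] i //=.
- by case: (eqVneq y x) => ?; case: ifP => // _ z.
- by case: ifP.
- move=> z; rewrite filter_cat !mem_cat => /orP[/IHt -> //|/IHu ->].
  by rewrite orbT.
elim/big_ind: _ => //= [a b IHa IHb z | j _ z]; rewrite mem_cat.
  by case/orP=> [/IHa|/IHb].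
by rewrite filter_cat mem_cat => /orP[/IHt -> //|/IHu ->]; rewrite orbT.
Qed.

(** * Comparison of numbers by their digits *)

Lemma digits_lt (c : nat -> nat) a n :
  (forall i, c i < a) -> \sum_(i < n) c i * a ^ i < a ^ n.
Proof.
move=> lt_ca; elim: n => [|n IHn]; first by rewrite big_ord0.
rewrite big_ord_recr /= expnS.
apply: (@leq_trans (a ^ n + c n * a ^ n)); first by rewrite ltn_add2r.
by rewrite -mulSn leq_mul2r lt_ca orbT.
Qed.

Fixpoint same_digits (c d : nat -> term) (n : nat) : formula :=
  if n is n'.+1 then And (Eq (c n') (d n')) (same_digits c d n')
  else Eq Zero Zero.

(** The most significant digit is read first; [Lt Zero Zero] plays falsity when no digit is left. *)
Fixpoint lower_digits (c d : nat -> term) (n : nat) : formula :=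
  if n is n'.+1 then
    Or (Lt (c n') (d n')) (And (Eq (c n') (d n')) (lower_digits c d n'))
  else Lt Zero Zero.

Section Digits.
Variables (s : nat -> nat) (c d : nat -> term) (a : nat).
Hypothesis lt_ca : forall i, eval s (c i) < a.
Hypothesis lt_da : forall i, eval s (d i) < a.
Let value (e : nat -> term) n := \sum_(i < n) eval s (e i) * a ^ i.

Let value_lt e n : (forall i, eval s (e i) < a) -> value e n < a ^ n.
Proof. by move=> lt_ea; apply: (@digits_lt (fun i => eval s (e i))). Qed.

Let valueS e n : value e n.+1 = value e n + eval s (e n) * a ^ n.
Proof. by rewrite /value big_ord_recr. Qed.

(** The digits below position [n] contribute less than [a ^ n], so a gap of one at position [n]
    decides. *)
Let value_ltS e f n : (forall i, eval s (e i) < a) ->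
  eval s (e n) < eval s (f n) -> value e n.+1 < value f n.+1.
Proof.
move=> lt_ea lt_ef; rewrite !valueS.
apply: (@leq_trans (a ^ n + eval s (e n) * a ^ n)).
  by rewrite ltn_add2r value_lt.
rewrite -mulSn; apply: leq_trans (leq_addl _ _).
by rewrite leq_mul2r lt_ef orbT.
Qed.

Lemma sat_same_digits n :
  value c n = value d n <-> sat s (same_digits c d n).
Proof.
elim: n => [|n IHn] /=; first by rewrite /value !big_ord0.
rewrite -IHn; case: (ltngtP (eval s (c n)) (eval s (d n))) => [lt|lt|e].
- have := value_ltS lt_ca lt; split=> [e|[e _]]; last by rewrite e ltnn in lt.
  by rewrite e ltnn in H.
- have := value_ltS lt_da lt; split=> [e|[e _]]; last by rewrite e ltnn in lt.
  by rewrite e ltnn in H.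
rewrite !valueS e; split=> [/addIn -> //|[_ -> //]].
Qed.

Lemma sat_lower_digits n :
  value c n < value d n <-> sat s (lower_digits c d n).
Proof.
elim: n => [|n IHn] /=; first by rewrite /value !big_ord0.
rewrite -IHn; case: (ltngtP (eval s (c n)) (eval s (d n))) => [lt|lt|e].
- have := value_ltS lt_ca lt; split=> // _; by left.
- have := ltnW (value_ltS lt_da lt); rewrite leqNgt => /negP lt'.
  by split=> // -[//|[e]]; rewrite e ltnn in lt.
rewrite !valueS e ltn_add2r; split=> [lt|[//|[_ //]]]; by right.
Qed.
End Digits.

(** Both polynomials have at most [deg t + deg u] coefficients, so no digit is lost. The value at a
    quantified formula is a placeholder: inner quantifiers are eliminated first. *)
Fixpoint limit (x : nat) (p : formula) : formula :=
  match p with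
  | Eq t u => same_digits (coef x t) (coef x u) (deg t + deg u)
  | Lt t u => lower_digits (coef x t) (coef x u) (deg t + deg u)
  | Not p => Not (limit x p)
  | And p q => And (limit x p) (limit x q)
  | Or p q => Or (limit x p) (limit x q)
  | Imp p q => Imp (limit x p) (limit x q)
  | Ex _ _ | All _ _ | Q _ _ => p
  end.

(** One predicate for three conditions on the terms of a formula: lying below a threshold, having
    variables in a given list, and being [bounded]. *)
Fixpoint fterms (P : term -> Prop) (p : formula) : Prop :=
  match p with
  | Eq t u | Lt t u => P t /\ P u
  | Not p | Ex _ p | All _ p | Q _ p => fterms P p
  | And p q | Or p q | Imp p q => fterms P p /\ fterms P q
  end.

Lemma fterms_sub (P P' : term -> Prop) p :
  (forall t, P t -> P' t) -> fterms P p -> fterms P' p.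
Proof. by move=> sPP'; elim: p => /= *; intuition. Qed.

Lemma quantifier_free_limit x p :
  quantifier_free p -> quantifier_free (limit x p).
Proof.
elim: p => //= [t u _|t u _|p IHp q IHq|p IHp q IHq|p IHp q IHq];
  try by case/andP=> /IHp -> /IHq.
- by elim: (deg t + deg u).
by elim: (deg t + deg u).
Qed.

Lemma fterms_limit (P P' : term -> Prop) x p :
  quantifier_free p -> P' Zero -> (forall t i, P t -> P' (coef x t i)) ->
  fterms P p -> fterms P' (limit x p).
Proof.
move=> + P'0 Pc.
elim: p => //= [t u _|t u _|p IHp q IHq|p IHp q IHq|p IHp q IHq];
  try by case/andP=> qp qq [Pp Pq]; split; [exact: IHp|exact: IHq].
- by case=> Pt Pu; elim: (deg t + deg u) => //= n IHn; split=> //; split; exact: Pc.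
case=> Pt Pu; elim: (deg t + deg u) => //= n IHn.
by split; split=> //; [exact: Pc..|split; exact: Pc].
Qed.

(** The equivalence is proved at each single [a] above the threshold, which lets it pass through
    negation and implication. *)
Lemma sat_limit s x a p : quantifier_free p ->
  fterms (fun t => eval [eta s with x |-> 1] t < a) p ->
  sat [eta s with x |-> a] p <-> sat s (limit x p).
Proof.
have lt_coef t i : eval [eta s with x |-> 1] t < a -> eval s (coef x t i) < a.
  exact: leq_ltn_trans (eval_coef_le s x t i).
elim: p => [t u|t u|p IHp|p IHp q IHq|p IHp q IHq|p IHp q IHq|||] //.
- move=> _ [ta ua]; rewrite -sat_same_digits; last first.
  + by move=> i; apply: lt_coef ua.
  + by move=> i; apply: lt_coef ta.
  by rewrite /sat (eval_coef _ _ _ (leq_addr (deg u) (deg t)))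
             (eval_coef _ _ _ (leq_addl (deg t) (deg u))).
- move=> _ [ta ua]; rewrite -sat_lower_digits; last first.
  + by move=> i; apply: lt_coef ua.
  + by move=> i; apply: lt_coef ta.
  by rewrite /sat (eval_coef _ _ _ (leq_addr (deg u) (deg t)))
             (eval_coef _ _ _ (leq_addl (deg t) (deg u))).
- by move=> qp fp; have := IHp qp fp; rewrite /=; tauto.
- by move=> /andP[qp qq] [fp fq]; have := IHp qp fp; have := IHq qq fq; rewrite /=; tauto.
- by move=> /andP[qp qq] [fp fq]; have := IHp qp fp; have := IHq qq fq; rewrite /=; tauto.
- by move=> /andP[qp qq] [fp fq]; have := IHp qp fp; have := IHq qq fq; rewrite /=; tauto.
Qed.

Lemma fterms_eventually (f : term -> nat) p :
  exists z, forall a, z < a -> fterms (fun t => f t < a) p.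
Proof.
have max_lt m n a : maxn m n < a -> m < a /\ n < a by rewrite gtn_max => /andP.
elim: p => //= [t u|t u|p [z1 h1] q [z2 h2]|p [z1 h1] q [z2 h2]|p [z1 h1] q [z2 h2]].
- by exists (maxn (f t) (f u)) => a /max_lt.
- by exists (maxn (f t) (f u)) => a /max_lt.
all: by exists (maxn z1 z2) => a /max_lt[] /h1 ? /h2.
Qed.

Lemma sat_Q_limit s x p : quantifier_free p ->
  sat s (Q x p) <-> sat s (limit x p).
Proof.
move=> qp; have [z hz] := fterms_eventually (eval [eta s with x |-> 1]) p.
split=> [[z' hz']|sp].
  have/hz/(sat_limit qp) <- : z < (maxn z z').+1 by rewrite ltnS leq_maxl.
  by apply: hz'; rewrite ltnS leq_maxr.
by exists z => a /hz/(sat_limit qp)/= ->.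
Qed.

Lemma fterms_free_vars p (xs : seq nat) : quantifier_free p ->
  fterms (fun t => {subset term_vars t <= xs}) p <-> {subset free_vars p <= xs}.
Proof.
have sub_cat (l m : seq nat) :
    {subset l <= xs} /\ {subset m <= xs} <-> {subset l ++ m <= xs}.
  split=> [[h1 h2] y|h]; first by rewrite mem_cat => /orP[/h1|/h2].
  by split=> y hy; apply: h; rewrite mem_cat hy ?orbT.
elim: p => //= [p IHp q IHq|p IHp q IHq|p IHp q IHq] /andP[qp qq];
  by rewrite -sub_cat IHp // IHq.
Qed.

Lemma quantifier_elimination (p : formula) : in_F p ->
  exists q : formula, [/\ quantifier_free q, {subset free_vars q <= free_vars p} &
                forall s, sat s p <-> sat s q].
Proof.
have sub_cat (a b c d : seq nat) : {subset a <= c} -> {subset b <= d} ->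
    {subset a ++ b <= c ++ d}.
  by move=> h1 h2 y; rewrite !mem_cat => /orP[/h1 ->|/h2 ->]; rewrite ?orbT.
elim=> {p} [p qp|p _ [p' [qp vp sp]]|p q _ [p' [qp vp sp]] _ [q' [qq vq sq]]
  |p q _ [p' [qp vp sp]] _ [q' [qq vq sq]]
  |p q _ [p' [qp vp sp]] _ [q' [qq vq sq]]|x p _ [p' [qp vp sp]]].
- by exists p; split=> // s; split.
- by exists (Not p'); split=> //= s; rewrite sp.
- by exists (And p' q'); split=> /= [||s]; rewrite ?qp ?sp ?sq //; exact: sub_cat.
- by exists (Or p' q'); split=> /= [||s]; rewrite ?qp ?sp ?sq //; exact: sub_cat.
- by exists (Imp p' q'); split=> /= [||s]; rewrite ?qp ?sp ?sq //; exact: sub_cat.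
exists (limit x p'); split; first exact: quantifier_free_limit.
  apply/fterms_free_vars; first exact: quantifier_free_limit.
  move/(fterms_free_vars _ qp): vp; apply: fterms_limit => // t i vt y.
  by move/term_vars_coef; rewrite !mem_filter => /andP[-> /vt].
move=> s; rewrite -sat_Q_limit //=.
by split=> -[z hz]; exists z => a /hz /sp.
Qed.

(** * Recursive functions *)

Definition recursive1 (f : nat -> nat) :=
  recursive (fun v : 1.-tuple nat => f (thead v)).

Definition recursive2 (g : nat -> nat -> nat) :=
  recursive (fun v : 2.-tuple nat => g (tnth v ord0) (tnth v ord_max)).

Lemma recursive_comp1 k (g : nat -> nat) (f : k.-tuple nat -> nat) :
  recursive1 g -> recursive f ->
  recursive (fun v => g (f v)).
Proof.
move=> rg rf.
apply: rec_ext (rec_comp (f := fun _ => f) rg (fun _ => rf)) _ => v.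
by rewrite /= /thead tnth_mktuple.
Qed.

Lemma recursive_comp2 k (g : nat -> nat -> nat) (f1 f2 : k.-tuple nat -> nat) :
  recursive2 g -> recursive f1 -> recursive f2 -> recursive (fun v => g (f1 v) (f2 v)).
Proof.
move=> rg rf1 rf2.
pose f (i : 'I_2) := if i == ord0 then f1 else f2.
have rf i : recursive (f i) by rewrite /f; case: ifP.
by apply: rec_ext (rec_comp rg rf) _ => v; rewrite !tnth_mktuple.
Qed.

Lemma recursive_const k c : recursive (fun _ : k.-tuple nat => c).
Proof.
elim: c => [|c IHc]; last exact: recursive_comp1 rec_succ IHc.
have f0 (i : 'I_0) : recursive (fun _ : k.-tuple nat => 0) by case: i.
exact: rec_ext (rec_comp rec_zero f0) _.
Qed.

Lemma recursive1_id : recursive1 id.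
Proof. exact: rec_proj. Qed.

Lemma recursive1_const c : recursive1 (fun=> c).
Proof. exact: recursive_const. Qed.

Lemma recursive1_ext f g : recursive1 f -> f =1 g -> recursive1 g.
Proof. by move=> rf fg; apply: rec_ext rf _ => v; apply: fg. Qed.

Lemma recursive2_rec (f : nat -> nat -> nat) (g : nat -> nat)
    (h : nat -> nat -> nat -> nat) :
  recursive1 g ->
  recursive (fun v : 3.-tuple nat =>
    h (tnth v (inord 0)) (tnth v (inord 1)) (tnth v (inord 2))) ->
  (forall x, f 0 x = g x) -> (forall n x, f n.+1 x = h n (f n x) x) ->
  recursive2 f.
Proof.
move=> rg rh f0 fS; apply: (rec_prim rg rh) => [v|n v].
  by rewrite !(tnth_nth 0) /= f0 /thead (tnth_nth 0).
by rewrite !(tnth_nth 0) /= !inordK //= fS.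
Qed.

Lemma recursive2_iter f : recursive1 f -> recursive2 (fun n x => iter n f x).
Proof.
move=> rf.
have rh := recursive_comp1 rf (rec_proj (inord 1 : 'I_3)).
exact: (recursive2_rec (h := fun _ y _ => f y) recursive1_id rh).
Qed.

Lemma recursive1_mu (g : nat -> nat -> nat) (f : nat -> nat) :
  recursive2 g -> (forall x, g (f x) x = 0) ->
  (forall x n, n < f x -> g n x <> 0) -> recursive1 f.
Proof.
move=> rg g0 gn0; apply: (rec_mu rg) => [v|v n lt_n].
  by rewrite !(tnth_nth 0) /= /thead (tnth_nth 0); apply: g0.
rewrite !(tnth_nth 0) /=; apply: gn0.
by move: lt_n; rewrite /thead (tnth_nth 0).
Qed.

Lemma recursive2_add : recursive2 addn.
Proof.
apply: rec_ext (recursive2_iter rec_succ) _ => v.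
by elim: (tnth v ord0) => //= n ->.
Qed.

Lemma recursive_add k (f g : k.-tuple nat -> nat) :
  recursive f -> recursive g -> recursive (fun v => f v + g v).
Proof. exact: recursive_comp2 recursive2_add. Qed.

Lemma recursive_mul k (f g : k.-tuple nat -> nat) :
  recursive f -> recursive g -> recursive (fun v => f v * g v).
Proof.
apply: recursive_comp2.
have rh : recursive (fun v : 3.-tuple nat =>
    tnth v (inord 2) + tnth v (inord 1)) by apply: recursive_add; exact: rec_proj.
exact: (recursive2_rec (h := fun _ y x => x + y) (recursive1_const 0) rh).
Qed.

Lemma recursive_exp k (f g : k.-tuple nat -> nat) :
  recursive f -> recursive g -> recursive (fun v => f v ^ g v).
Proof.
move=> rf rg; apply: (recursive_comp2 (g := fun n x => x ^ n) _ rg rf).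
have rh : recursive (fun v : 3.-tuple nat =>
    tnth v (inord 2) * tnth v (inord 1)) by apply: recursive_mul; exact: rec_proj.
apply: (recursive2_rec (f := fun n x => x ^ n) (h := fun _ y x => x * y) (recursive1_const 1) rh) => //.
by move=> n x; rewrite expnS.
Qed.

Lemma recursive1_pred : recursive1 predn.
Proof.
(* The recursion scheme carries a parameter, here a dummy copy of the argument. *)
apply: (recursive_comp2 (g := fun n _ => n.-1) _ recursive1_id recursive1_id).
exact: (recursive2_rec (f := fun n _ => n.-1) (h := fun n _ _ => n) (recursive1_const 0) (rec_proj _)).
Qed.

Lemma recursive_sub k (f g : k.-tuple nat -> nat) :
  recursive f -> recursive g -> recursive (fun v => f v - g v).
Proof.
move=> rf rg; apply: (recursive_comp2 (g := fun n x => x - n) _ rg rf).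
apply: rec_ext (recursive2_iter recursive1_pred) _ => v.
by elim: (tnth v ord0) => [|n /= ->]; rewrite ?subn0 ?subnS.
Qed.

Definition decides k (b : k.-tuple nat -> bool) := recursive (fun v => b v : nat).

Lemma decides_eq k (f g : k.-tuple nat -> nat) :
  recursive f -> recursive g -> decides (fun v => f v == g v).
Proof.
move=> rf rg.
(* Subtraction is truncated, so the sum of the two differences vanishes exactly on equality. *)
have r := recursive_sub (recursive_const k 1)
  (recursive_add (recursive_sub rf rg) (recursive_sub rg rf)).
apply: rec_ext r _ => v; rewrite eqn_leq -!subn_eq0.
by case: (f v - g v) (g v - f v) => [|m] [|n].
Qed.

Lemma decides_leq k (f g : k.-tuple nat -> nat) :
  recursive f -> recursive g -> decides (fun v => f v <= g v).
Proof. by move=> rf rg; apply: decides_eq (recursive_sub rf rg) (recursive_const _ _). Qed.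

Lemma recursive_if k (b : k.-tuple nat -> bool) (f g : k.-tuple nat -> nat) :
  decides b -> recursive f -> recursive g ->
  recursive (fun v => if b v then f v else g v).
Proof.
move=> rb rf rg.
have r := recursive_add (recursive_mul rb rf)
  (recursive_mul (recursive_sub (recursive_const k 1) rb) rg).
apply: rec_ext r _ => v; case: (b v) => /=; first by rewrite mul1n addn0.
by rewrite subn0 mul1n.
Qed.

Lemma recursive_bool k (b : k.-tuple nat -> bool) :
  decides b -> recursive (fun v => b v : nat).
Proof. by []. Qed.

Lemma decides_if k (b c d : k.-tuple nat -> bool) :
  decides b -> decides c -> decides d ->
  decides (fun v => if b v then c v else d v).
Proof.
move=> rb rc rd; apply: rec_ext (recursive_if rb rc rd) _ => v.
by case: (b v).
Qed.

Lemma decides_const k (c : bool) : decides (fun _ : k.-tuple nat => c).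
Proof. exact: recursive_const. Qed.

Lemma recursive1_divn d : recursive1 (divn^~ d.+1).
Proof.
(* The quotient is the least [q] with [c < q.+1 * d.+1], that is, the first zero of this truncated
   difference. *)
apply: (@recursive1_mu (fun q c => c.+1 - q.+1 * d.+1)).
- apply: recursive_sub.
    exact: recursive_comp1 rec_succ (rec_proj _).
  apply: recursive_mul (recursive_const _ _).
  exact: recursive_comp1 rec_succ (rec_proj _).
- by move=> c; apply/eqP; rewrite subn_eq0 -ltn_divLR.
move=> c q lt_q /eqP; rewrite subn_eq0 -ltn_divLR //.
by rewrite ltnS leqNgt lt_q.
Qed.

Lemma recursive_divn k d (f : k.-tuple nat -> nat) :
  recursive f -> recursive (fun v => f v %/ d.+1).
Proof. exact: recursive_comp1 (recursive1_divn d). Qed.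

Lemma recursive_modn k d (f : k.-tuple nat -> nat) :
  recursive f -> recursive (fun v => f v %% d.+1).
Proof.
move=> rf.
have r := recursive_sub rf
  (recursive_mul (recursive_divn d rf) (recursive_const k d.+1)).
apply: rec_ext r _ => v.
by rewrite {1}(divn_eq (f v) d.+1) addKn.
Qed.

Ltac prove_recursive :=
  try assumption;
  lazymatch goal with
  | |- recursive1 _ => unfold recursive1; prove_recursive
  | |- recursive2 _ => unfold recursive2; prove_recursive
  | |- recursive (fun v => thead v) => exact: rec_proj
  | |- recursive (@thead _ _) => exact: rec_proj
  | |- recursive (fun v => tnth v _) => exact: rec_proj
  | |- recursive (fun _ => ?c) => exact: recursive_const
  | |- recursive (fun v => nat_of_bool (@?b v)) =>
      apply: (@recursive_bool _ b); prove_recursive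
  | |- recursive (fun v => S (@?f v)) =>
      apply: (@recursive_comp1 _ S f); [exact: rec_succ | prove_recursive]
  | |- recursive (fun v => predn (@?f v)) =>
      apply: (@recursive_comp1 _ predn f);
      [exact: recursive1_pred | prove_recursive]
  | |- recursive (fun v => addn (@?f v) (@?g v)) =>
      apply: (@recursive_add _ f g); prove_recursive
  | |- recursive (fun v => muln (@?f v) (@?g v)) =>
      apply: (@recursive_mul _ f g); prove_recursive
  | |- recursive (fun v => subn (@?f v) (@?g v)) =>
      apply: (@recursive_sub _ f g); prove_recursive
  | |- recursive (fun v => expn (@?f v) (@?g v)) =>
      apply: (@recursive_exp _ f g); prove_recursive
  | |- recursive (fun v => divn (@?f v) ?d) =>
      apply: (@recursive_divn _ _ f); prove_recursive
  | |- recursive (fun v => modn (@?f v) ?d) =>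
      apply: (@recursive_modn _ _ f); prove_recursive
  | |- recursive (fun v => if _ then _ else _) =>
      eapply recursive_if; prove_recursive
  | |- recursive (fun v => ?f (@?g v) (@?h v) (@?i v)) => idtac
  | |- recursive (fun v => ?f (@?g v) (@?h v)) =>
      apply: (@recursive_comp2 _ f g h);
      [solve [eauto with recursive] | prove_recursive | prove_recursive]
  | |- recursive (fun v => ?f (@?g v)) =>
      apply: (@recursive_comp1 _ f g);
      [solve [eauto with recursive] | prove_recursive]
  | |- decides (fun _ => ?c) => exact: decides_const
  | |- decides (fun v => eq_op (@?f v) (@?g v)) =>
      apply: (@decides_eq _ f g); prove_recursive
  | |- decides (fun v => leq (@?f v) (@?g v)) =>
      apply: (@decides_leq _ f g); prove_recursive
  | |- decides (fun v => if _ then _ else _) =>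
      eapply decides_if; prove_recursive
  | |- decides (fun v => andb (@?f v) (@?g v)) =>
      apply: (@decides_if _ f g (fun _ => false)); prove_recursive
  | |- decides (fun v => orb (@?f v) (@?g v)) =>
      apply: (@decides_if _ f (fun _ => true) g); prove_recursive
  | |- decides (fun v => negb (@?f v)) =>
      apply: (@decides_if _ f (fun _ => false) (fun _ => true)); prove_recursive
  | |- _ => idtac
  end.

(** * Cantor pairing, its inverses, and lists coded by numbers *)

Definition triangle n := 'C(n.+1, 2).

Lemma triangleS n : triangle n.+1 = triangle n + n.+1.
Proof. by rewrite /triangle binS bin1. Qed.

Lemma leq_triangle n : n <= triangle n.
Proof. by case: n => // n; rewrite triangleS leq_addl. Qed.

Lemma recursive1_triangle : recursive1 triangle.
Proof.
have r : recursive2 (fun n _ => triangle n).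
  have rh : recursive (fun v : 3.-tuple nat =>
      tnth v (inord 1) + (tnth v (inord 0)).+1) by prove_recursive.
  apply: (recursive2_rec (h := fun n y _ => y + n.+1) (recursive1_const 0) rh) => //.
  by move=> n _; rewrite triangleS.
exact: recursive_comp2 r recursive1_id recursive1_id.
Qed.

Hint Resolve recursive1_triangle : recursive.

Lemma recursive2_pair_code : recursive2 pair_code.
Proof.
rewrite /recursive2 /pair_code.
have r : recursive (fun v : 2.-tuple nat =>
    triangle (tnth v ord0 + tnth v ord_max) + tnth v ord_max).
  by prove_recursive.
exact: r.
Qed.

Hint Resolve recursive2_pair_code : recursive.

Lemma triangle_exceeds c : exists n, c < triangle n.+1.
Proof. by exists c; apply: leq_trans (leq_triangle _). Qed.

(** The sum [a + b] of the pair coded by [c]: its antidiagonal in Cantor's enumeration. As a least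
    number it can also be reached by minimization. *)
Definition diagonal c := ex_minn (triangle_exceeds c).
Definition snd_code c := c - triangle (diagonal c).
Definition fst_code c := diagonal c - snd_code c.

Lemma diagonalP c :
  triangle (diagonal c) <= c < triangle (diagonal c).+1.
Proof.
rewrite /diagonal; case: ex_minnP => -[|n] -> min_n; first by [].
rewrite andbT leqNgt; apply/negP => /min_n.
by rewrite ltnn.
Qed.

Lemma snd_code_le c : snd_code c <= diagonal c.
Proof.
have /andP[le lt] := diagonalP c.
by rewrite /snd_code leq_subLR -ltnS -addnS -triangleS.
Qed.

Lemma pair_codeK c : pair_code (fst_code c) (snd_code c) = c.
Proof.
have /andP[le lt] := diagonalP c.
rewrite /pair_code /fst_code subnK ?snd_code_le //.
by rewrite -/(triangle _) /snd_code subnKC.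
Qed.

Lemma fst_pair_code a b : fst_code (pair_code a b) = a.
Proof. by case: (pair_code_inj (pair_codeK (pair_code a b))). Qed.

Lemma snd_pair_code a b : snd_code (pair_code a b) = b.
Proof. by case: (pair_code_inj (pair_codeK (pair_code a b))). Qed.

Lemma pair_code_ge a b : a + b <= pair_code a b.
Proof. exact: leq_trans (leq_triangle _) (leq_addr _ _). Qed.

Lemma recursive1_diagonal : recursive1 diagonal.
Proof.
apply: (@recursive1_mu (fun n c => c.+1 - triangle n.+1)).
- by prove_recursive.
- by move=> c; apply/eqP; rewrite subn_eq0; have /andP[] := diagonalP c.
move=> c n; rewrite /diagonal; case: ex_minnP => m _ min_m lt_nm /eqP.
by rewrite subn_eq0 => /min_m; rewrite leqNgt lt_nm.
Qed.

Hint Resolve recursive1_diagonal : recursive.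

Lemma recursive1_snd_code : recursive1 snd_code.
Proof. by rewrite /recursive1 /snd_code; prove_recursive. Qed.

Hint Resolve recursive1_snd_code : recursive.

Lemma recursive1_fst_code : recursive1 fst_code.
Proof. by rewrite /recursive1 /fst_code; prove_recursive. Qed.

Hint Resolve recursive1_fst_code : recursive.

(** The successor reserves 0 for the empty list. *)
Definition cons_code a l := (pair_code a l).+1.
Definition head_code l := fst_code l.-1.
Definition tail_code l := snd_code l.-1.

Lemma recursive2_cons_code : recursive2 cons_code.
Proof.
have r : recursive (fun v : 2.-tuple nat =>
    (pair_code (tnth v ord0) (tnth v ord_max)).+1) by prove_recursive.
exact: r.
Qed.

Lemma recursive1_head_code : recursive1 head_code.
Proof. by rewrite /recursive1 /head_code; prove_recursive. Qed.

Lemma recursive1_tail_code : recursive1 tail_code.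
Proof. by rewrite /recursive1 /tail_code; prove_recursive. Qed.

Hint Resolve recursive2_cons_code recursive1_head_code recursive1_tail_code
  : recursive.

Lemma head_cons_code a l : head_code (cons_code a l) = a.
Proof. exact: fst_pair_code. Qed.

Lemma tail_cons_code a l : tail_code (cons_code a l) = l.
Proof. exact: snd_pair_code. Qed.

(** * Binary tree recursion on a stack machine *)

Section TreeRecursion.
Variables (leaf : nat -> bool) (base left right : nat -> nat).
Variable combine : nat -> nat -> nat -> nat.

(** A relation rather than a function, since [left] and [right] need not descend in any order; a
    derivation is a finite tree and so certifies termination. *)
Inductive tree_value : nat -> nat -> Prop :=
  | TreeLeaf z : leaf z -> tree_value z (base z)
  | TreeNode z v w : ~~ leaf z -> tree_value (left z) v ->
      tree_value (right z) w -> tree_value z (combine z v w).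

(* A state of the stack machine is a pair of a stack of tasks and a stack of
   values; the task [(0, z)] evaluates [z], and [(1, z)] combines the two top
   values at [z]. *)
Definition machine_step st :=
  let tasks := fst_code st in let values := snd_code st in
  let task := head_code tasks in let z := snd_code task in
  let rest := tail_code tasks in
  if tasks == 0 then st else
  if fst_code task == 0 then
    if leaf z then pair_code rest (cons_code (base z) values)
    else pair_code (cons_code (pair_code 0 (left z))
           (cons_code (pair_code 0 (right z))
             (cons_code (pair_code 1 z) rest))) values
  else pair_code rest
    (cons_code (combine z (head_code (tail_code values)) (head_code values))
       (tail_code (tail_code values))).

Definition machine_run n z :=
  iter n machine_step (pair_code (cons_code (pair_code 0 z) 0) 0).

Let codeE := (head_cons_code, tail_cons_code, fst_pair_code, snd_pair_code).

Lemma step_leaf z tasks values : leaf z ->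
  machine_step (pair_code (cons_code (pair_code 0 z) tasks) values) =
  pair_code tasks (cons_code (base z) values).
Proof. by move=> lz; rewrite /machine_step !codeE /= lz. Qed.

Lemma step_node z tasks values : ~~ leaf z ->
  machine_step (pair_code (cons_code (pair_code 0 z) tasks) values) =
  pair_code (cons_code (pair_code 0 (left z)) (cons_code (pair_code 0 (right z))
    (cons_code (pair_code 1 z) tasks))) values.
Proof. by move=> lz; rewrite /machine_step !codeE /= (negbTE lz). Qed.

Lemma step_combine z v w tasks values :
  machine_step (pair_code (cons_code (pair_code 1 z) tasks)
                          (cons_code w (cons_code v values))) =
  pair_code tasks (cons_code (combine z v w) values).
Proof. by rewrite /machine_step !codeE. Qed.

Lemma machine_eval z v : tree_value z v -> forall tasks values,
  exists n, iter n machine_step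
      (pair_code (cons_code (pair_code 0 z) tasks) values) =
    pair_code tasks (cons_code v values).
Proof.
elim=> {z v} [z lz|z v w lz _ IHv _ IHw] tasks values.
  by exists 1; rewrite /= step_leaf.
have [n1 run1] := IHv (cons_code (pair_code 0 (right z))
  (cons_code (pair_code 1 z) tasks)) values.
have [n2 run2] := IHw (cons_code (pair_code 1 z) tasks) (cons_code v values).
(* Read from the right: one step expands the node, [n1] steps evaluate the left subtree, [n2] the
   right one, and one step combines. *)
exists (1 + (n2 + (n1 + 1))); rewrite !iterD.
by rewrite [iter 1 _ (pair_code _ _)]/= step_node // run1 run2 /= step_combine.
Qed.

Lemma machine_halts z v : tree_value z v ->
  exists n, fst_code (machine_run n z) == 0.
Proof.
by case/machine_eval/(_ 0 0) => n run; exists n; rewrite /machine_run run !codeE.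
Qed.

(** A state without tasks is a fixed point of the step. *)
Lemma machine_halted m n z : m <= n -> fst_code (machine_run m z) = 0 ->
  machine_run n z = machine_run m z.
Proof.
move=> /subnK <- halted; rewrite /machine_run iterD -/(machine_run m z).
by elim: (n - m) => //= k ->; rewrite /machine_step halted.
Qed.

Hypothesis leafR : decides (fun v : 1.-tuple nat => leaf (thead v)).
Hypotheses (baseR : recursive1 base).
Hypotheses (leftR : recursive1 left) (rightR : recursive1 right).
Hypothesis combineR : recursive1 (fun x =>
  combine (fst_code x) (fst_code (snd_code x)) (snd_code (snd_code x))).

Lemma recursive_combine k (f g h : k.-tuple nat -> nat) :
  recursive f -> recursive g -> recursive h ->
  recursive (fun v => combine (f v) (g v) (h v)).
Proof.
move=> rf rg rh; pose x v := pair_code (f v) (pair_code (g v) (h v)).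
have rx : recursive x by rewrite /x; prove_recursive.
by apply: rec_ext (recursive_comp1 combineR rx) _ => v; rewrite /x !codeE.
Qed.

Lemma decides_leaf k (f : k.-tuple nat -> nat) :
  recursive f -> decides (fun v => leaf (f v)).
Proof. exact: (recursive_comp1 (g := fun x => leaf x)). Qed.

Lemma recursive1_machine_step : recursive1 machine_step.
Proof.
rewrite /recursive1 /machine_step; cbv zeta; prove_recursive.
- by apply: decides_leaf; prove_recursive.
by apply: recursive_combine; prove_recursive.
Qed.

Lemma recursive_tree_value (g f : nat -> nat) :
  recursive1 g -> (forall x, tree_value (g x) (f x)) -> recursive1 f.
Proof.
move=> rg fP.
pose time x := ex_minn (machine_halts (fP x)).
have runR : recursive2 (fun n x => machine_run n (g x)).
  rewrite /recursive2 /machine_run.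
  have itR := recursive2_iter recursive1_machine_step.
  apply: (recursive_comp2 itR); first exact: rec_proj.
  by prove_recursive.
have halted x : fst_code (machine_run (time x) (g x)) = 0.
  by rewrite /time; case: ex_minnP => n /eqP.
have min_time x n : fst_code (machine_run n (g x)) = 0 -> time x <= n.
  by move=> /eqP; rewrite /time; case: ex_minnP => m _; apply.
(* Every [g x] has a finite evaluation tree, so the search for the first halting time is a regular
   minimization. *)
have timeR : recursive1 time.
  apply: (@recursive1_mu (fun n x => fst_code (machine_run n (g x)))) => //.
    exact: recursive_comp1 recursive1_fst_code runR.
  by move=> x n lt_n /min_time; rewrite leqNgt lt_n.
have r : recursive1 (fun x => head_code (snd_code (machine_run (time x) (g x)))).
  apply: recursive_comp1 recursive1_head_code _.
  apply: recursive_comp1 recursive1_snd_code _.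
  exact: recursive_comp2 runR timeR recursive1_id.
apply: recursive1_ext r _ => x /=.
(* The run length [m] may exceed the first halting time; both end in the same state. *)
have [m run] := machine_eval (fP x) 0 0.
have halted_m : fst_code (machine_run m (g x)) = 0.
  by rewrite /machine_run run codeE.
rewrite -(machine_halted (min_time _ _ halted_m) (halted x)).
by rewrite /machine_run run !codeE.
Qed.
End TreeRecursion.

(** * Evaluation of sentences *)

Fixpoint assign (e : seq (nat * nat)) : nat -> nat :=
  if e is (x, a) :: e' then [eta assign e' with x |-> a] else fun=> 0.

(** The code serves twice: as data for the machine and as an upper bound on all values in the
    environment. *)
Fixpoint env_code (e : seq (nat * nat)) : nat :=
  if e is (x, a) :: e' then cons_code (pair_code x a) (env_code e') else 0.

(** With [c] the code of an environment, the base [c.+2] is greater than 1 and bounds all its values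
    as well as the value 1 put in for [x]; the final successor makes the bound strict. *)
Definition large N c := (c.+2 ^ N).+1.

Lemma assign_le e y : assign e y <= env_code e.
Proof.
elim: e => //= -[x a] e IHe /=; rewrite /cons_code.
have h1 := pair_code_ge x a; have h2 := pair_code_ge (pair_code x a) (env_code e).
case: (y == x).
  by apply/ltnW; rewrite ltnS; apply: leq_trans h2; apply: leq_trans (leq_addr _ _);
     apply: leq_trans h1; rewrite leq_addl.
by apply: leq_trans IHe _; apply/ltnW; rewrite ltnS; apply: leq_trans h2; rewrite leq_addl.
Qed.

(* Unlike a bound on the size of [t], this one is inherited by the
   coefficients of [t]. *)
Definition bounded N t :=
  forall M s, 1 < M -> (forall y, s y <= M) -> eval s t <= M ^ N.

Lemma bounded_leq m n t : m <= n -> bounded m t -> bounded n t.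
Proof.
move=> le_mn bt M s M1 sM; apply: leq_trans (bt M s M1 sM) _.
by rewrite leq_pexp2l // ltnW.
Qed.

Lemma bounded_coef N x t i : bounded N t -> bounded N (coef x t i).
Proof.
move=> bt M s M1 sM; apply: leq_trans (eval_coef_le _ _ _ _) _.
by apply: bt => // y /=; case: (y == x); rewrite // ltnW.
Qed.

(** Codes exceed the sum of the codes of the subterms. For a product the exponents add up; for a
    sum, [M ^ a + M ^ b <= 2 * M ^ (a + b) <= M ^ (a + b + 1)] as [1 < M]. So a code can serve as
    its own exponent, with no parsing. *)
Lemma bounded_term_code t : bounded (term_code t) t.
Proof.
have le3 m a b i : m <= a + b + i -> m <= 3 * pair_code a b + i.
  move/leq_trans; apply; rewrite leq_add2r (leq_trans (pair_code_ge a b)) //.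
  by rewrite leq_pmull.
move=> M s M1 sM; have M0 := ltnW M1.
elim: t => [x|||t IHt u IHu|t IHt u IHu]; cbn [eval term_code].
- apply: leq_trans (sM x) _; rewrite -[leqLHS]expn1.
  by apply: leq_pexp2l; rewrite // addnS.
- by [].
- by rewrite expn1.
- apply: (@leq_trans (M ^ (term_code t + term_code u + 1))).
    apply: (@leq_trans (2 * M ^ (term_code t + term_code u))).
      rewrite mul2n -addnn; apply: leq_add.
        by apply: leq_trans IHt _; apply: leq_pexp2l; rewrite // leq_addr.
      by apply: leq_trans IHu _; apply: leq_pexp2l; rewrite // leq_addl.
    by rewrite addn1 expnS leq_mul2r M1 orbT.
  by apply: leq_pexp2l => //; apply: le3; rewrite leq_add2l.
apply: leq_trans (leq_mul IHt IHu) _; rewrite -expnD.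
by apply: leq_pexp2l => //; apply: le3; exact: leq_addr.
Qed.

Lemma bounded_formula_code p : fterms (bounded (formula_code p)) p.
Proof.
have le9 a b i : a <= 9 * pair_code a b + i /\ b <= 9 * pair_code a b + i.
  have h := pair_code_ge a b; have h9 : pair_code a b <= 9 * pair_code a b + i.
    by apply: leq_trans (leq_addr _ _); rewrite leq_pmull.
  by split; apply: leq_trans h9; apply: leq_trans h; rewrite ?leq_addr ?leq_addl.
have terms t u i : bounded (9 * pair_code (term_code t) (term_code u) + i) t /\
    bounded (9 * pair_code (term_code t) (term_code u) + i) u.
  have [h1 h2] := le9 (term_code t) (term_code u) i.
  by split; [apply: bounded_leq h1 _|apply: bounded_leq h2 _]; exact: bounded_term_code.
have mono q m n : m <= n -> fterms (bounded m) q -> fterms (bounded n) q.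
  by move=> le_mn; apply: fterms_sub => t; apply: bounded_leq.
elim: p => [t u|t u|p IHp|p IHp q IHq|p IHp q IHq|p IHp q IHq|x p IHp|x p IHp|x p IHp];
  cbn [fterms formula_code]; try exact: terms.
- by apply: mono IHp; apply: leq_trans (leq_addr _ _); rewrite leq_pmull.
all: try by have [h1 h2] := le9 (formula_code p) (formula_code q) 3;
  split; [apply: mono h1 IHp|apply: mono h2 IHq].
all: try by have [h1 h2] := le9 (formula_code p) (formula_code q) 4;
  split; [apply: mono h1 IHp|apply: mono h2 IHq].
all: try by have [h1 h2] := le9 (formula_code p) (formula_code q) 5;
  split; [apply: mono h1 IHp|apply: mono h2 IHq].
- by have [_ h] := le9 x (formula_code p) 6; apply: mono h IHp.
- by have [_ h] := le9 x (formula_code p) 7; apply: mono h IHp.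
- by have [_ h] := le9 x (formula_code p) 8; apply: mono h IHp.
Qed.

(** * Truth in environments of fast-growing values *)

Fixpoint sparse N (e : seq (nat * nat)) : Prop :=
  if e is (x, a) :: e' then large N (env_code e') <= a /\ sparse N e' else True.

Lemma bounded_sparse N x a e t : large N (env_code e) <= a -> bounded N t ->
  eval [eta assign e with x |-> 1] t < a.
Proof.
move=> le_a bt; apply: leq_trans le_a; rewrite ltnS; apply: bt => // y /=.
by case: (y == x); rewrite // ltnW // ltnW // !ltnS assign_le.
Qed.

(** Both head values exceed the threshold of [sat_limit], so on either side [p] may be replaced by
    the same formula [limit x p], whose terms are still [N]-bounded. Repeating this empties both
    environments. *)
Lemma sat_sparse_qf N e e' p : map fst e = map fst e' ->
  sparse N e -> sparse N e' -> quantifier_free p -> fterms (bounded N) p ->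
  sat (assign e) p <-> sat (assign e') p.
Proof.
elim: e e' p => [|[x a] e IHe] [|[y b] e'] p //= [<-] eq_dom [le_a sp] [le_b sp'] qp bp.
rewrite !sat_limit //.
- apply: IHe => //; first exact: quantifier_free_limit.
  by apply: fterms_limit bp => // t i; exact: bounded_coef.
- by apply: fterms_sub bp => t; exact: bounded_sparse.
by apply: fterms_sub bp => t; exact: bounded_sparse.
Qed.

Fixpoint Q_only (p : formula) : bool :=
  match p with
  | Eq _ _ | Lt _ _ => true
  | Not p | Q _ p => Q_only p
  | And p q | Or p q | Imp p q => Q_only p && Q_only q
  | Ex _ _ | All _ _ => false
  end.

Lemma Q_onlyP p : reflect (in_F p) (Q_only p).
Proof.
apply: (iffP idP).
  elim: p => //= [t u _|t u _|p IHp /IHp|p IHp q IHq|p IHp q IHq|p IHp q IHq|x p IHp /IHp];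
    try by [exact: F_qf|exact: F_not|exact: F_Q].
  - by case/andP=> /IHp ? /IHq; exact: F_and.
  - by case/andP=> /IHp ? /IHq; exact: F_or.
  by case/andP=> /IHp ? /IHq; exact: F_imp.
elim=> //= {p} [p|p q _ -> _ ->|p q _ -> _ ->|p q _ -> _ ->] //.
by elim: p => //= p IHp q IHq /andP[/IHp -> /IHq].
Qed.

Lemma sat_sparse N e e' p : map fst e = map fst e' ->
  sparse N e -> sparse N e' -> Q_only p -> fterms (bounded N) p ->
  sat (assign e) p <-> sat (assign e') p.
Proof.
elim: p e e' => [t u|t u|p IHp|p IHp q IHq|p IHp q IHq|p IHp q IHq|x p IHp|x p IHp|x p IHp]
  e e' eq_dom sp sp' //=.
- by move=> _ bp; exact: (@sat_sparse_qf N e e' (Eq t u)).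
- by move=> _ bp; exact: (@sat_sparse_qf N e e' (Lt t u)).
- by move=> Qp bp; rewrite (IHp e e').
- by case/andP=> Qp Qq [bp bq]; rewrite (IHp e e') // (IHq e e').
- by case/andP=> Qp Qq [bp bq]; rewrite (IHp e e') // (IHq e e').
- by case/andP=> Qp Qq [bp bq]; rewrite (IHp e e') // (IHq e e').
have Q_transfer f f' : map fst f = map fst f' -> sparse N f -> sparse N f' ->
    Q_only p -> fterms (bounded N) p ->
    sat (assign f) (Q x p) -> sat (assign f') (Q x p).
  move=> eq_f spf spf' Qp bp [z hz]; exists (large N (env_code f')) => a lt_a.
  (* Both [a] and [b] extend their environments sparsely, so the induction hypothesis compares them;
     [b] moreover lies beyond [z], where [p] is known to hold. *)
  pose b := maxn z.+1 (large N (env_code f)).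
  rewrite -/(assign ((x, a) :: f')) -(IHp ((x, b) :: f)) //=; first last.
  - by split=> //; exact: ltnW.
  - by split=> //; exact: leq_maxr.
  - by rewrite eq_f.
  by apply: hz; exact: leq_maxl.
by move=> Qp bp; split; exact: Q_transfer.
Qed.

(** All extensions of [e] by a value from the threshold on are sparse with the same variables, so
    the truth of [p] is constant there and one test suffices. *)
Lemma sat_Q_sparse N e x p : sparse N e -> Q_only p -> fterms (bounded N) p ->
  sat (assign e) (Q x p) <-> sat (assign ((x, large N (env_code e)) :: e)) p.
Proof.
move=> sp Qp bp.
have hE a : large N (env_code e) <= a -> sat (assign ((x, a) :: e)) p <->
    sat (assign ((x, large N (env_code e)) :: e)) p.
  by move=> le_a; apply: (@sat_sparse N).
split=> [[z hz]|hp].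
  apply/(hE (maxn z.+1 (large N (env_code e)))); first exact: leq_maxr.
  by apply: hz; exact: leq_maxl.
by exists (large N (env_code e)) => a /ltnW /hE ->.
Qed.

(* Value 0 signals an unbound variable or a first-order quantifier; otherwise a
   term of value [a] gets [a.+1], and a formula gets 1 or 2. *)
Definition lift2 (op : nat -> nat -> nat) v w :=
  if (v == 0) || (w == 0) then 0 else (op v.-1 w.-1).+1.

Fixpoint lookup (e : seq (nat * nat)) (x : nat) : nat :=
  if e is (y, a) :: e' then (if y == x then a.+1 else lookup e' x) else 0.

Fixpoint term_value e (t : term) : nat :=
  match t with
  | Var x => lookup e x
  | Zero => 1
  | One => 2
  | Add t u => lift2 addn (term_value e t) (term_value e u)
  | Mul t u => lift2 muln (term_value e t) (term_value e u)
  end.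

Fixpoint formula_value N e (p : formula) : nat :=
  match p with
  | Eq t u => lift2 (fun a b => a == b) (term_value e t) (term_value e u)
  | Lt t u => lift2 (fun a b => a < b) (term_value e t) (term_value e u)
  | Not p => let v := formula_value N e p in lift2 (fun a _ => a == 0) v v
  | And p q => lift2 muln (formula_value N e p) (formula_value N e q)
  | Or p q => lift2 (fun a b => a + b != 0) (formula_value N e p) (formula_value N e q)
  | Imp p q => lift2 (fun a b => a <= b) (formula_value N e p) (formula_value N e q)
  | Ex _ _ | All _ _ => 0
  | Q x p => formula_value N ((x, large N (env_code e)) :: e) p
  end.

Lemma term_valueE e t : term_value e t =
  if all (mem (map fst e)) (term_vars t) then (eval (assign e) t).+1 else 0.
Proof.
elim: t => [x|||t IHt u IHu|t IHt u IHu] //=.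
- rewrite andbT; elim: e => //= -[y a] e IHe /=.
  by rewrite in_cons eq_sym; case: (x == y).
- by rewrite all_cat IHt IHu; do 2!case: (all _ _).
by rewrite all_cat IHt IHu; do 2!case: (all _ _).
Qed.

Variant formula_value_spec (closed : bool) (P : Prop) : nat -> Prop :=
  | ValueUndefined of ~~ closed : formula_value_spec closed P 0
  | ValueFalse of closed & ~ P : formula_value_spec closed P 1
  | ValueTrue of closed & P : formula_value_spec closed P 2.

Lemma formula_valueP N e p : sparse N e -> fterms (bounded N) p ->
  formula_value_spec (Q_only p && all (mem (map fst e)) (free_vars p))
    (sat (assign e) p) (formula_value N e p).
Proof.
elim: p e => [t u|t u|p IHp|p IHp q IHq|p IHp q IHq|p IHp q IHq|x p IHp|x p IHp|x p IHp]
  e sp //=.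
- move=> _; rewrite all_cat !term_valueE.
  do 2!case: (all _ _) => /=; try by constructor.
  by rewrite /lift2 /=; case: eqP; constructor.
- move=> _; rewrite all_cat !term_valueE.
  do 2!case: (all _ _) => /=; try by constructor.
  by rewrite /lift2 /=; case: ltnP => h; constructor=> //; rewrite ltnNge h.
- move=> bp; case: (IHp e sp bp) => [/negbTE->|->|->] *;
    by rewrite /lift2 /=; constructor.
- case=> bp bq; rewrite all_cat andbACA.
  case: (IHp e sp bp) => [/negbTE->|->|->] *;
  case: (IHq e sp bq) => [/negbTE->|->|->] *;
    by rewrite /lift2 /=; constructor; rewrite ?andbF //; tauto.
- case=> bp bq; rewrite all_cat andbACA.
  case: (IHp e sp bp) => [/negbTE->|->|->] *;
  case: (IHq e sp bq) => [/negbTE->|->|->] *;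
    by rewrite /lift2 /=; constructor; rewrite ?andbF //; tauto.
- case=> bp bq; rewrite all_cat andbACA.
  case: (IHp e sp bp) => [/negbTE->|->|->] *;
  case: (IHq e sp bq) => [/negbTE->|->|->] *;
    by rewrite /lift2 /=; constructor; rewrite ?andbF //; tauto.
- by move=> _; constructor.
- by move=> _; constructor.
move=> bp; set e' := (x, large N (env_code e)) :: e.
have -> : all (mem (map fst e)) [seq y <- free_vars p | y != x] =
    all (mem (map fst e')) (free_vars p).
  rewrite all_filter; apply: eq_all => y /=.
  by rewrite in_cons; case: (y == x).
have sp' : sparse N e' by split.
case: (IHp e' sp' bp) => [?|/andP[Qp vp] h|/andP[Qp vp] h]; constructor=> //.
- by rewrite Qp.
- by move/(sat_Q_sparse x sp Qp bp).
- by rewrite Qp.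
by apply/(sat_Q_sparse x sp Qp bp).
Qed.

Lemma sat_free_vars s s' p : {in free_vars p, s =1 s'} -> sat s p <-> sat s' p.
Proof.
have eval_eq t r r' : {in term_vars t, r =1 r'} -> eval r t = eval r' t.
  elim: t => [x|||t IHt u IHu|t IHt u IHu] //= eq_r.
  - by rewrite eq_r ?mem_head.
  - by rewrite IHt ?IHu // => y hy; apply: eq_r; rewrite mem_cat hy ?orbT.
  by rewrite IHt ?IHu // => y hy; apply: eq_r; rewrite mem_cat hy ?orbT.
have cat_eq (l m : seq nat) r r' : {in l ++ m, r =1 r'} ->
    {in l, r =1 r'} /\ {in m, (r : nat -> nat) =1 r'}.
  by move=> eq_r; split=> y hy; apply: eq_r; rewrite mem_cat hy ?orbT.
have bind_eq x (l : seq nat) (r r' : nat -> nat) a : {in [seq y <- l | y != x], r =1 r'} ->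
    {in l, [eta r with x |-> a] =1 [eta r' with x |-> a]}.
  by move=> eq_r y hy /=; case: eqVneq => // nxy; apply: eq_r; rewrite mem_filter nxy.
elim: p s s' => [t u|t u|p IHp|p IHp q IHq|p IHp q IHq|p IHp q IHq|x p IHp|x p IHp|x p IHp]
  s s' /= => [/cat_eq[h1 h2]|/cat_eq[h1 h2]|h|/cat_eq[h1 h2]|/cat_eq[h1 h2]
             |/cat_eq[h1 h2]|h|h|h].
- by rewrite (eval_eq _ _ _ h1) (eval_eq _ _ _ h2).
- by rewrite (eval_eq _ _ _ h1) (eval_eq _ _ _ h2).
- by rewrite (IHp _ _ h).
- by rewrite (IHp _ _ h1) (IHq _ _ h2).
- by rewrite (IHp _ _ h1) (IHq _ _ h2).
- by rewrite (IHp _ _ h1) (IHq _ _ h2).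
- have hE a := IHp _ _ (bind_eq _ _ _ _ a h).
  by split=> -[a /hE]; exists a.
- have hE a := IHp _ _ (bind_eq _ _ _ _ a h).
  by split=> hp a; apply/hE.
have hE a := IHp _ _ (bind_eq _ _ _ _ a h).
by split=> -[z hz]; exists z => a /hz /hE.
Qed.

(** In the empty environment the value 0 catches open formulas and first-order quantifiers alike, so
    the value 2 expresses all three clauses of [F_theory]. *)
Lemma F_theoryP p :
  F_theory p <-> formula_value (formula_code p) [::] p = 2.
Proof.
have closedE : all (mem [::]) (free_vars p) = (free_vars p == [::]).
  by case: (free_vars p).
have := @formula_valueP (formula_code p) [::] p I (bounded_formula_code p).
rewrite closedE.
case=> [open|/andP[Qp _] h|/andP[Qp /eqP cl] h]; split=> //.
- by case=> /Q_onlyP Qp cl _; rewrite Qp cl in open.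
- by case=> _ _ /(_ (assign [::])).
move=> _; split=> // [|s]; first exact/Q_onlyP.
by apply/(sat_free_vars (s := assign [::])) => // y; rewrite cl.
Qed.

(** * Evaluation of codes as a tree recursion *)

Definition task kind N c e := pair_code (pair_code kind N) (pair_code c e).
Definition kind_of z := fst_code (fst_code z).
Definition budget_of z := snd_code (fst_code z).
Definition code_of z := fst_code (snd_code z).
Definition env_of z := snd_code (snd_code z).

Lemma taskE kind N c e :
  (kind_of (task kind N c e) = kind) * (budget_of (task kind N c e) = N) *
  (code_of (task kind N c e) = c) * (env_of (task kind N c e) = e).
Proof.
rewrite /kind_of /budget_of /code_of /env_of /task.
by rewrite !(fst_pair_code, snd_pair_code).
Qed.

(* Term codes from 2 on are read as [3 * m + i + 2], with [i = 0] for a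
   variable, [1] for a sum and [2] for a product. *)
Definition term_tag z := (code_of z - 2) %% 3.
Definition term_arg z := (code_of z - 2) %/ 3.
Definition formula_tag z := code_of z %% 9.
Definition formula_arg z := code_of z %/ 9.

(** Kind 0 is a term, any other kind a formula. A variable that differs from the head of a nonempty
    environment is not a leaf: its lookup continues as a recursion on the tail. *)
Definition is_leaf z :=
  if kind_of z == 0 then
    if code_of z < 2 then true
    else if term_tag z == 0 then
      if env_of z == 0 then true
      else fst_code (head_code (env_of z)) == term_arg z
    else false
  else if formula_tag z == 6 then true else formula_tag z == 7.

Definition leaf_value z :=
  if kind_of z == 0 then
    if code_of z < 2 then (code_of z).+1
    else if env_of z == 0 then 0 else (snd_code (head_code (env_of z))).+1
  else 0.

Definition only_child z :=
  if kind_of z == 0 then task 0 (budget_of z) (code_of z) (tail_code (env_of z))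
  else if formula_tag z == 2 then
    task 1 (budget_of z) (formula_arg z) (env_of z)
  else task 1 (budget_of z) (snd_code (formula_arg z))
    (cons_code (pair_code (fst_code (formula_arg z))
                          (large (budget_of z) (env_of z))) (env_of z)).

(** To fit the binary scheme, such a node gets its only child on both sides, at the cost of
    evaluating it twice. *)
Definition unary z :=
  if kind_of z == 0 then term_tag z == 0
  else if formula_tag z == 2 then true else formula_tag z == 8.

Definition child (proj : nat -> nat) z :=
  if unary z then only_child z
  else if kind_of z == 0 then
    task 0 (budget_of z) (proj (term_arg z)) (env_of z)
  else if formula_tag z < 2 then
    task 0 (budget_of z) (proj (formula_arg z)) (env_of z)
  else task 1 (budget_of z) (proj (formula_arg z)) (env_of z).

Definition operation z a b : nat :=
  if kind_of z == 0 then
    if term_tag z == 0 then a else if term_tag z == 1 then a + b else a * b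
  else if formula_tag z == 0 then nat_of_bool (a == b)
  else if formula_tag z == 1 then nat_of_bool (a < b)
  else if formula_tag z == 2 then nat_of_bool (a == 0)
  else if formula_tag z == 3 then a * b
  else if formula_tag z == 4 then nat_of_bool (a + b != 0)
  else if formula_tag z == 5 then nat_of_bool (a <= b)
  else a.

Definition combine_values z := lift2 (operation z).

Definition evaluates := tree_value is_leaf leaf_value (child fst_code)
  (child snd_code) combine_values.

Lemma evaluates_node z u l r v w : ~~ is_leaf z ->
  child fst_code z = l -> child snd_code z = r ->
  evaluates l v -> evaluates r w -> combine_values z v w = u -> evaluates z u.
Proof. by move=> lz <- <- lv rw <-; exact: TreeNode. Qed.

Lemma evaluates_leaf z v : is_leaf z -> leaf_value z = v -> evaluates z v.
Proof. by move=> lz <-; exact: TreeLeaf. Qed.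

Lemma lift2_fst v : lift2 (fun a _ => a) v v = v.
Proof. by case: v. Qed.

Lemma tagE d m i : i < d -> (d * m + i) %% d = i /\ (d * m + i) %/ d = m.
Proof.
move=> lt_id; have d0 : 0 < d by case: d lt_id.
by rewrite mulnC modnMDl divnMDl // modn_small // divn_small // addn0.
Qed.

Lemma term_tagE N m i e : i < 3 -> let z := task 0 N (3 * m + i.+2) e in
  [/\ code_of z < 2 = false, term_tag z = i & term_arg z = m].
Proof.
move=> lt_i z; rewrite /term_tag /term_arg /z !taskE !addnS subn2.
by have [-> ->] := tagE m lt_i.
Qed.

Lemma formula_tagE N m i e : i < 9 -> let z := task 1 N (9 * m + i) e in
  formula_tag z = i /\ formula_arg z = m.
Proof. by move=> lt_i z; rewrite /formula_tag /formula_arg /z !taskE; exact: tagE. Qed.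

Lemma evaluates_term N e t :
  evaluates (task 0 N (term_code t) (env_code e)) (term_value e t).
Proof.
elim: t => [x|||t IHt u IHu|t IHt u IHu].
- elim: e => [|[y a] e IHe]; cbn [term_value term_code lookup].
    have [lt2 tag arg] := @term_tagE N x 0 (env_code [::]) isT.
    apply: evaluates_leaf; first by rewrite /is_leaf lt2 tag !taskE.
    by rewrite /leaf_value lt2 !taskE.
  have [] := @term_tagE N x 0 (env_code ((y, a) :: e)) isT.
  set z := task _ _ _ _ => lt2 tag arg.
  have headE : head_code (env_of z) = pair_code y a by rewrite taskE head_cons_code.
  have tailE : tail_code (env_of z) = env_code e by rewrite taskE tail_cons_code.
  have env_n0 : (env_of z == 0) = false by rewrite taskE.
  have kindE : kind_of z = 0 by rewrite taskE.
  case: (eqVneq y x) => [eq_yx|ne_yx].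
    apply: evaluates_leaf.
      by rewrite /is_leaf kindE lt2 tag env_n0 headE fst_pair_code arg eq_yx /= eqxx.
    by rewrite /leaf_value kindE lt2 env_n0 headE snd_pair_code.
  apply: (evaluates_node _ _ _ IHe IHe).
  - by rewrite /is_leaf kindE lt2 tag env_n0 headE fst_pair_code arg.
  - by rewrite /child /unary /only_child kindE tag tailE /= !taskE.
  - by rewrite /child /unary /only_child kindE tag tailE /= !taskE.
  by rewrite /combine_values /operation kindE tag lift2_fst.
- by apply: evaluates_leaf; rewrite /is_leaf /leaf_value !taskE.
- by apply: evaluates_leaf; rewrite /is_leaf /leaf_value !taskE.
all: cbn [term_value term_code].
- have [] := @term_tagE N (pair_code (term_code t) (term_code u)) 1 (env_code e) isT.
  set z := task _ _ _ _ => lt2 tag arg.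
  have kindE : kind_of z = 0 by rewrite taskE.
  apply: (evaluates_node _ _ _ IHt IHu).
  - by rewrite /is_leaf kindE lt2 tag.
  - by rewrite /child /unary kindE tag arg fst_pair_code !taskE.
  - by rewrite /child /unary kindE tag arg snd_pair_code !taskE.
  by rewrite /combine_values /operation kindE tag.
have [] := @term_tagE N (pair_code (term_code t) (term_code u)) 2 (env_code e) isT.
set z := task _ _ _ _ => lt2 tag arg.
have kindE : kind_of z = 0 by rewrite taskE.
apply: (evaluates_node _ _ _ IHt IHu).
- by rewrite /is_leaf kindE lt2 tag.
- by rewrite /child /unary kindE tag arg fst_pair_code !taskE.
- by rewrite /child /unary kindE tag arg snd_pair_code !taskE.
by rewrite /combine_values /operation kindE tag.
Qed.

Lemma evaluates_formula N p e :
  evaluates (task 1 N (formula_code p) (env_code e)) (formula_value N e p).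
Proof.
(* The two atoms and the three binary connectives are treated together; for tags 0 and 1 the
   children are terms. *)
move: e; have binary e i x y v w op : i < 9 -> i \notin [:: 2; 6; 7; 8] ->
    let z := task 1 N (9 * pair_code x y + i) (env_code e) in
    let kind := if i < 2 then 0 else 1 in
    operation z =2 op ->
    evaluates (task kind N x (env_code e)) v ->
    evaluates (task kind N y (env_code e)) w -> evaluates z (lift2 op v w).
  move=> lt_i ni z kind opE ev_x ev_y.
  have [tag arg] := formula_tagE N (pair_code x y) (env_code e) lt_i.
  rewrite -/z in tag arg; rewrite !inE !negb_or in ni; case/and4P: ni => n2 n6 n7 n8.
  have kindE : kind_of z = 1 by rewrite taskE.
  apply: (evaluates_node _ _ _ ev_x ev_y).
  - by rewrite /is_leaf kindE tag (negbTE n6).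
  - rewrite /child /unary kindE tag arg (negbTE n2) (negbTE n8) fst_pair_code /=.
    by rewrite /kind; case: ifP; rewrite !taskE.
  - rewrite /child /unary kindE tag arg (negbTE n2) (negbTE n8) snd_pair_code /=.
    by rewrite /kind; case: ifP; rewrite !taskE.
  by rewrite /combine_values /lift2 opE.
have opE e i m a b : i < 9 -> operation (task 1 N (9 * m + i) (env_code e)) a b =
    if i == 0 then nat_of_bool (a == b) else if i == 1 then nat_of_bool (a < b)
    else if i == 2 then nat_of_bool (a == 0) else if i == 3 then a * b
    else if i == 4 then nat_of_bool (a + b != 0)
    else if i == 5 then nat_of_bool (a <= b) else a.
  by move=> lt_i; rewrite /operation !taskE; have [-> _] := formula_tagE N m (env_code e) lt_i.
elim: p => [t u|t u|p IHp|p IHp q IHq|p IHp q IHq|p IHp q IHq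
  |x p IHp|x p IHp|x p IHp] e; cbn [formula_value formula_code].
- apply: binary => // [a b||]; [exact: opE|exact: evaluates_term..].
- apply: binary => // [a b||]; [exact: opE|exact: evaluates_term..].
- have [tag arg] := formula_tagE N (formula_code p) (env_code e) (isT : 2 < 9).
  set z := task _ _ _ _ in tag arg *.
  have kindE : kind_of z = 1 by rewrite taskE.
  have childE proj : child proj z = task 1 N (formula_code p) (env_code e).
    by rewrite /child /unary /only_child kindE tag arg /= !taskE.
  apply: (evaluates_node _ (childE _) (childE _) (IHp e) (IHp e)).
    by rewrite /is_leaf kindE tag.
  by rewrite /combine_values /lift2 opE.
- by apply: binary => // a b; exact: opE.
- by apply: binary => // a b; exact: opE.
- by apply: binary => // a b; exact: opE.
- have [tag _] := formula_tagE N (pair_code x (formula_code p)) (env_code e) (isT : 6 < 9).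
  by apply: evaluates_leaf; rewrite /is_leaf /leaf_value ?tag !taskE.
- have [tag _] := formula_tagE N (pair_code x (formula_code p)) (env_code e) (isT : 7 < 9).
  by apply: evaluates_leaf; rewrite /is_leaf /leaf_value ?tag !taskE.
have [tag arg] := formula_tagE N (pair_code x (formula_code p)) (env_code e) (isT : 8 < 9).
set z := task _ _ _ _ in tag arg *.
have kindE : kind_of z = 1 by rewrite taskE.
set e' := (x, large N (env_code e)) :: e.
have childE proj : child proj z = task 1 N (formula_code p) (env_code e').
  rewrite /child /unary /only_child kindE tag arg /= !taskE.
  by rewrite fst_pair_code snd_pair_code.
apply: (evaluates_node _ (childE _) (childE _) (IHp e') (IHp e')).
  by rewrite /is_leaf kindE tag.
(* A quantifier node passes on the common value of its two equal children. *)
rewrite -[RHS]lift2_fst /combine_values /lift2 opE //.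
Qed.

(** * Decoding and the decision procedure *)

Lemma decode_term n : {t | term_code t = n}.
Proof.
elim/ltn_ind: n => -[|[|n]] IH; [by exists Zero|by exists One|].
have nE : n.+2 = 3 * (n %/ 3) + (n %% 3).+2 by rewrite !addnS mulnC -divn_eq.
have lt_mod : n %% 3 < 3 by rewrite ltn_mod.
have arg_lt : n %/ 3 < n.+2 by rewrite ltnS (leq_trans (leq_div n 3)).
have le_arg : fst_code (n %/ 3) + snd_code (n %/ 3) <= n %/ 3.
  by rewrite -{3}(pair_codeK (n %/ 3)) pair_code_ge.
have [t tE] := IH (fst_code (n %/ 3))
  (leq_ltn_trans (leq_trans (leq_addr _ _) le_arg) arg_lt).
have [u uE] := IH (snd_code (n %/ 3))
  (leq_ltn_trans (leq_trans (leq_addl _ _) le_arg) arg_lt).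
rewrite nE; case: (n %% 3) lt_mod => [|[|[|//]]] _.
- by exists (Var (n %/ 3)).
- by exists (Add t u); rewrite /= tE uE pair_codeK.
by exists (Mul t u); rewrite /= tE uE pair_codeK.
Qed.

(** All nine remainders are used as tags and pairing is onto, so every number is a code and no input
    has to be rejected as malformed. *)
Lemma decode_formula n : {p | formula_code p = n}.
Proof.
elim/ltn_ind: n => n IH.
have nE : n = 9 * (n %/ 9) + n %% 9 by rewrite mulnC -divn_eq.
have lt_mod : n %% 9 < 9 by rewrite ltn_mod.
have le_arg : fst_code (n %/ 9) + snd_code (n %/ 9) <= n %/ 9.
  by rewrite -{3}(pair_codeK (n %/ 9)) pair_code_ge.
have [t tE] := decode_term (fst_code (n %/ 9)).
have [u uE] := decode_term (snd_code (n %/ 9)).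
(* Division by 9 does not decrease 0, which codes [Eq Zero Zero]. *)
have [->|n_gt0] := posnP n; first by exists (Eq Zero Zero).
have arg_lt : n %/ 9 < n by rewrite ltn_Pdiv.
have [p pE] := IH (fst_code (n %/ 9))
  (leq_ltn_trans (leq_trans (leq_addr _ _) le_arg) arg_lt).
have [q qE] := IH (snd_code (n %/ 9))
  (leq_ltn_trans (leq_trans (leq_addl _ _) le_arg) arg_lt).
have [r rE] := IH (n %/ 9) arg_lt.
have argE := pair_codeK (n %/ 9).
rewrite nE; case: (n %% 9) lt_mod => [|[|[|[|[|[|[|[|[|//]]]]]]]]] _.
- by exists (Eq t u); cbn [formula_code]; rewrite tE uE argE.
- by exists (Lt t u); cbn [formula_code]; rewrite tE uE argE.
- by exists (Not r); cbn [formula_code]; rewrite rE.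
- by exists (And p q); cbn [formula_code]; rewrite pE qE argE.
- by exists (Or p q); cbn [formula_code]; rewrite pE qE argE.
- by exists (Imp p q); cbn [formula_code]; rewrite pE qE argE.
- by exists (Ex (fst_code (n %/ 9)) q); cbn [formula_code]; rewrite qE argE.
- by exists (All (fst_code (n %/ 9)) q); cbn [formula_code]; rewrite qE argE.
by exists (Q (fst_code (n %/ 9)) q); cbn [formula_code]; rewrite qE argE.
Qed.

Ltac unfold_evaluator :=
  rewrite /unary /only_child /leaf_value /is_leaf /combine_values /operation
    /lift2 /task /large /term_tag /term_arg /formula_tag /formula_arg
    /kind_of /budget_of /code_of /env_of.

Lemma decides_is_leaf : decides (fun v : 1.-tuple nat => is_leaf (thead v)).
Proof. by unfold_evaluator; prove_recursive. Qed.

Lemma recursive1_leaf_value : recursive1 leaf_value.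
Proof. by rewrite /recursive1; unfold_evaluator; prove_recursive. Qed.

Lemma recursive1_child proj : recursive1 proj -> recursive1 (child proj).
Proof. by move=> rp; rewrite /recursive1 /child; unfold_evaluator; prove_recursive. Qed.

Lemma recursive1_combine : recursive1 (fun x =>
  combine_values (fst_code x) (fst_code (snd_code x)) (snd_code (snd_code x))).
Proof. by rewrite /recursive1; unfold_evaluator; prove_recursive. Qed.

Lemma decidable_F_theory : decidable_formulas F_theory.
Proof.
(* Decoding only specifies [f]; the machine works on the codes themselves and never decodes. *)
pose f n := formula_value n [::] (sval (decode_formula n)).
have fR : recursive1 f.
  (* The initial task uses [n] both as the formula to evaluate and as the exponent of the bounds; 0
     is the empty environment. *)
  apply: (recursive_tree_value decides_is_leaf recursive1_leaf_value
    (recursive1_child recursive1_fst_code) (recursive1_child recursive1_snd_code)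
    recursive1_combine (g := fun n => task 1 n n 0)).
    by rewrite /recursive1 /task; prove_recursive.
  move=> n; rewrite /f; case: (decode_formula n) => p pE /=.
  by rewrite -{2}pE; exact: (evaluates_formula n p [::]).
exists (fun v => f (thead v) == 2); first exact: decides_eq fR (recursive_const _ _).
move=> n; rewrite theadE /f; case: (decode_formula n) => p /= <-; split.
  by case=> q /formula_code_inj <- /F_theoryP ->.
by case: eqP => // h []; exists p => //; apply/F_theoryP.
Qed.

Theorem corollary2p2 :
  decidable_formulas F_theory /\
  (forall (xs : seq nat) (phi : formula),
     in_F phi -> {subset free_vars phi <= xs} ->
     exists psi : formula,
       [/\ quantifier_free psi, {subset free_vars psi <= xs} &
           forall s : nat -> nat, sat s phi <-> sat s psi]).
Proof.
split=> [|xs phi Fphi sub]; first exact: decidable_F_theory.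
have [psi [qf vars equiv]] := quantifier_elimination Fphi.
by exists psi; split=> // y /vars /sub.
Qed.
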